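(* There is an algorithm that, given positive integers $B$ and $k$ and a graph $G=(V,E)$ with $n=|V|$ vertices, $m=|E|$ edges and maximum degree at most $B$, decides whether $G$ has a vertex cover with at most $m/B+k$ vertices in time $O(2^{kB}n^{O(1)})$. In particular, the problem Vertex Cover Above Tight Lower Bound-1 (VCL1), with parameters $k$ and $B$, is fixed-parameter tractable.
   Context: A vertex cover of a graph is a set of vertices containing at least one endpoint of every edge. VCL1: given a positive integer $B$, a graph $G$ with $m$ edges and maximum degree at most $B$, and a positive integer $k$, decide whether $G$ has a vertex cover of at most $m/B+k$ vertices; the parameters are $k$ and $B$. A parameterized problem is fixed-parameter tractable if it can be decided in time $f(\text{parameters})\cdot|I|^{O(1)}$ for a computable $f$. *)

(* Defs.v *)
From mathcomp Require Import all_boot.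
Set Implicit Arguments. Unset Strict Implicit. Unset Printing Implicit Defensive.

(* A graph on vertex set {0,...,n-1} given by its list of edges (ordered
   pairs, each unordered edge listed exactly once, no loops). *)
Definition simple_graph (n : nat) (E : seq (nat * nat)) : bool :=
  all (fun e => [&& e.1 < n, e.2 < n & e.1 != e.2]) E &&
  uniq [seq (minn e.1 e.2, maxn e.1 e.2) | e <- E].

Definition degree (E : seq (nat * nat)) (v : nat) : nat :=
  count (fun e => (e.1 == v) || (e.2 == v)) E.

Definition max_degree_le (n : nat) (E : seq (nat * nat)) (B : nat) : bool :=
  all (fun v => degree E v <= B) (iota 0 n).

Definition vertex_cover (n : nat) (E : seq (nat * nat)) (C : seq nat) : bool :=
  [&& uniq C, all (fun v => v < n) C &
      all (fun e => (e.1 \in C) || (e.2 \in C)) E].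

(* G has a vertex cover with at most m/B + k vertices, m = |E|, B > 0;
   |C| <= m/B + k  is written as  |C| * B <= m + k * B. *)
Definition VCL1 (n : nat) (E : seq (nat * nat)) (B k : nat) : Prop :=
  exists C, vertex_cover n E C /\ size C * B <= size E + k * B.

Inductive expr : Type :=
  | Const of nat
  | Var of nat
  | Read of nat & expr
  | Add of expr & expr
  | Sub of expr & expr
  | Lt of expr & expr
  | Eq of expr & expr.

Inductive cmd : Type :=
  | Skip
  | Assign of nat & expr
  | Write of nat & expr & expr
  | Seq of cmd & cmd
  | If of expr & cmd & cmd
  | While of expr & cmd.

Record state := State { vars : nat -> nat; mem : nat -> nat -> nat }.

Fixpoint eval (s : state) (e : expr) : nat :=
  match e with
  | Const c => c
  | Var x => vars s x
  | Read a i => mem s a (eval s i)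
  | Add e1 e2 => eval s e1 + eval s e2
  | Sub e1 e2 => eval s e1 - eval s e2
  | Lt e1 e2 => nat_of_bool (eval s e1 < eval s e2)
  | Eq e1 e2 => nat_of_bool (eval s e1 == eval s e2)
  end.

Definition set_var (s : state) (x v : nat) : state :=
  State (fun y => if y == x then v else vars s y) (mem s).

Definition set_mem (s : state) (a i v : nat) : state :=
  State (vars s)
        (fun b j => if (b == a) && (j == i) then v else mem s b j).

Inductive exec : cmd -> state -> nat -> state -> Prop :=
  | ExSkip s : exec Skip s 1 s
  | ExAssign s x e : exec (Assign x e) s 1 (set_var s x (eval s e))
  | ExWrite s a e1 e2 :
      exec (Write a e1 e2) s 1 (set_mem s a (eval s e1) (eval s e2))
  | ExSeq c1 c2 s1 s2 s3 t1 t2 :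
      exec c1 s1 t1 s2 -> exec c2 s2 t2 s3 -> exec (Seq c1 c2) s1 (t1 + t2) s3
  | ExIfT b c1 c2 s t s' :
      eval s b != 0 -> exec c1 s t s' -> exec (If b c1 c2) s t.+1 s'
  | ExIfF b c1 c2 s t s' :
      eval s b = 0 -> exec c2 s t s' -> exec (If b c1 c2) s t.+1 s'
  | ExWhileF b c s : eval s b = 0 -> exec (While b c) s 1 s
  | ExWhileT b c s1 s2 s3 t1 t2 :
      eval s1 b != 0 -> exec c s1 t1 s2 -> exec (While b c) s2 t2 s3 ->
      exec (While b c) s1 (t1 + t2).+1 s3.

Definition input_list (n : nat) (E : seq (nat * nat)) (B k : nat) : seq nat :=
  [:: n, size E, B, k & flatten [seq [:: e.1; e.2] | e <- E]].

Definition init_state (n : nat) (E : seq (nat * nat)) (B k : nat) : state :=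
  State (fun _ => 0)
        (fun a i => if a == 0 then nth 0 (input_list n E B k) i else 0).

(* Output: register 0 holds 1 for "yes" and 0 for "no". *)
Definition answer (b : bool) : nat := if b then 1 else 0.

(* Main.v *)
(* A double cover of G is a pair (X, Y) of vertex sets such that each edge uv
   satisfies u in X or v in Y, and v in X or u in Y; half the least value of
   |X| + |Y| is the optimum of the vertex cover linear program. If all degrees
   are at most B this optimum is at least m/B, so a cover with at most m/B + k
   vertices exceeds it by at most k.

   Grow a partial cover D by treating the vertices v in turn. If adding v, or
   else adding all neighbours of v, keeps the optimum over the double covers
   containing D, persistency shows that this choice is safe. Otherwise both
   choices raise |X| + |Y| by at least 1, and the choice is read from a guessed
   bit string; at most 2k bits are ever needed, and 4^k <= 2^(kB) once B >= 2.
   For B = 1 the answer is always yes. Trying all 4^k strings is the algorithm.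

   The optimum is a maximum matching of a bipartite graph. It is computed by an
   auction: a bidder without an item takes an adjacent item of least price from
   its holder, and the price rises by 1; bidders give up at price n + 1. *)

From mathcomp Require Import all_boot zify.
Require Import Defs.
Set Implicit Arguments. Unset Strict Implicit. Unset Printing Implicit Defensive.

(** * Double covers and branching *)

Section DoubleCover.
Variables (T : finType) (e : rel T).
Implicit Types (C D X Y : {set T}) (u v w : T) (Dr : {set T} * nat).

(** In the bipartite double graph, where every vertex has a left and a right copy, [X] picks left
    copies and [Y] right copies. With [X = Y] this is an ordinary vertex cover. *)
Definition covers X Y := [forall u, forall v, e u v ==> (u \in X) || (v \in Y)].

Lemma coversP X Y : reflect (forall u v, e u v -> (u \in X) || (v \in Y)) (covers X Y).
Proof.
apply: (iffP forallP) => [h u v euv | h u].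
  by move: (h u) => /forallP /(_ v) /implyP; apply.
by apply/forallP => v; apply/implyP; apply: h.
Qed.

Definition double_cover D (XY : {set T} * {set T}) :=
  [&& D \subset XY.1, D \subset XY.2 & covers XY.1 XY.2].

(* Twice the optimum of the linear program in which D is forced into the cover. *)
Definition lp D :=
  let XY := [arg min_(XY < (setT, setT) | double_cover D XY) (#|XY.1| + #|XY.2|)] in
  #|XY.1| + #|XY.2|.

Lemma double_coverT D : double_cover D (setT, setT).
Proof. by rewrite /double_cover !subsetT; apply/coversP => u v _; rewrite inE. Qed.

Lemma lp_min D X Y : double_cover D (X, Y) -> lp D <= #|X| + #|Y|.
Proof.
move=> cXY; rewrite /lp.
by case: arg_minnP => [|XY _ /(_ _ cXY)]; first exact: double_coverT.
Qed.

Lemma lp_attained D : exists X Y, double_cover D (X, Y) /\ #|X| + #|Y| = lp D.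
Proof.
rewrite /lp; case: arg_minnP => [|[X Y] cXY _]; first exact: double_coverT.
by exists X, Y.
Qed.

Lemma lp_mono D D' : D \subset D' -> lp D <= lp D'.
Proof.
move=> sDD'; have [X [Y [/and3P[/= sX sY cXY] <-]]] := lp_attained D'.
by apply: lp_min; rewrite /double_cover /= cXY !(subset_trans sDD').
Qed.

Lemma lp_le_cover D C : D \subset C -> covers C C -> lp D <= #|C|.*2.
Proof. by move=> sDC cC; rewrite -addnn lp_min // /double_cover /= sDC. Qed.

(** For an optimal pair, every arc has its tail in [X] or its head in [Y], and each element of [X]
    or of [Y] accounts for at most [B] arcs. *)
Lemma lp_degree B :
  (forall u, #|[set v | e u v]| <= B) -> (forall v, #|[set u | e u v]| <= B) ->
  #|[set a : T * T | e a.1 a.2]| <= lp set0 * B.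
Proof.
move=> outB inB; have [X [Y [/and3P[/= _ _ /coversP cXY] <-]]] := lp_attained set0.
have card_pairs (A : {set T}) (F : T -> {set T * T}) : (forall u, #|F u| <= B) ->
    #|\bigcup_(u in A) F u| <= #|A| * B.
  move=> FB; apply: (leq_trans (n := \sum_(u in A) #|F u|)).
    elim/big_rec2: _ => [|u k S _ IH]; first by rewrite cards0.
    by apply: leq_trans (leq_card_setU _ _) _; rewrite leq_add2l.
  by rewrite -sum_nat_const leq_sum.
rewrite mulnDl.
apply: leq_trans (leq_add (card_pairs X (fun u => setX [set u] [set v | e u v]) _)
   (card_pairs Y (fun v => setX [set u | e u v] [set v]) _)).
- apply: leq_trans (leq_card_setU _ _); apply: subset_leq_card; apply/subsetP => -[u v].
  rewrite !inE /= => euv; case/orP: (cXY _ _ euv) => h; apply/orP; [left|right].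
    by apply/bigcupP; exists u; rewrite // !inE eqxx.
  by apply/bigcupP; exists v; rewrite // !inE eqxx euv.
- by move=> u; rewrite cardsX cards1 mul1n.
- by move=> v; rewrite cardsX cards1 muln1.
Qed.

Hypothesis e_sym : symmetric e.

(* The majority of C, X, Y is a cover, while their meet and join form a double
   cover; the three sizes add up to those of C, X and Y. *)
Lemma lp_persistent D D' C : D \subset D' -> lp D' = lp D -> D \subset C ->
  covers C C -> exists C', [/\ D' \subset C', covers C' C' & #|C'| <= #|C|].
Proof.
move=> sDD' eq_lp sDC /coversP cC.
have [X [Y [/and3P[/= sX sY /coversP cXY] val]]] := lp_attained D'.
pose C' := (X :&: Y) :|: (C :&: (X :|: Y)).
exists C'; split.
- by apply/subsetP => v v_in; rewrite !inE (subsetP sX) // (subsetP sY).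
- apply/coversP => u v euv; have evu : e v u by rewrite e_sym.
  move: (cC _ _ euv) (cXY _ _ euv) (cXY _ _ evu); rewrite !inE.
  by do !case: (_ \in _).
(* Since [lp D = lp D' = #|X| + #|Y|], this bound leaves at most [#|C|] for [C'] once the sizes are
   added up. *)
have : lp D <= #|X :&: Y :&: C| + #|X :|: Y :|: C|.
  apply: lp_min; apply/and3P; split=> /=.
  - by rewrite !subsetI sDC !(subset_trans sDD').
  - by rewrite (subset_trans sDC) // subsetUr.
  - apply/coversP => u v euv; have evu : e v u by rewrite e_sym.
    move: (cC _ _ euv) (cXY _ _ euv) (cXY _ _ evu); rewrite !inE.
    by do !case: (_ \in _).
have := cardsUI (X :&: Y) (C :&: (X :|: Y)).
have := cardsUI X Y; have := cardsUI C (X :|: Y).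
have -> : X :&: Y :&: (C :&: (X :|: Y)) = X :&: Y :&: C.
  by apply/setP => v; rewrite !inE; do !case: (_ \in _).
rewrite (setUC C) -/C'; lia.
Qed.

Definition nbrs v : {set T} := [set u | e v u].

(* The unread guesses are the binary digits of the fraction r / top, where top is a
   power of 2: doubling r moves the leading digit to the left of the point. *)
Definition branch top v (Dr : {set T} * nat) : {set T} * nat :=
  let: (D, r) := Dr in
  if lp (v |: D) == lp D then (v |: D, r)
  else if lp (D :|: nbrs v) == lp D then (D :|: nbrs v, r)
  else if r + r < top then (D :|: nbrs v, r + r) else (v |: D, r + r - top).

Definition branches top vs Dr := foldl (fun Dr v => branch top v Dr) Dr vs.

Lemma branch_sub top v Dr : Dr.1 \subset (branch top v Dr).1.
Proof.
by case: Dr => D r /=; do !case: ifP => _ /=; rewrite ?subsetUl ?subsetUr.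
Qed.

Lemma branches_sub top vs Dr : Dr.1 \subset (branches top vs Dr).1.
Proof.
elim: vs Dr => //= v vs IH Dr; apply: subset_trans (IH _).
exact: branch_sub.
Qed.

(** At its turn [u] enters the partial cover, or else all its neighbours do, and nothing is ever
    removed. This holds for every guess, so a bad guess can only make the cover too large. *)
Lemma branches_cover top vs Dr u v : u \in vs -> e u v ->
  (u \in (branches top vs Dr).1) || (v \in (branches top vs Dr).1).
Proof.
elim: vs Dr => //= w vs IH Dr; rewrite inE; case/predU1P => [<-|/IH]; last by apply.
move=> euv.
have: (u \in (branch top u Dr).1) || (v \in (branch top u Dr).1).
  by case: Dr => D r /=; do !case: ifP => _ /=; rewrite !inE ?eqxx ?euv ?orbT.
by case/orP => /(subsetP (branches_sub top vs (branch top u Dr))) ->; rewrite ?orbT.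
Qed.

(* Whenever a guess is consumed, both alternatives increase [lp], so at most
   [2 #|C| - lp D] guesses are needed to follow the cover C. *)
Lemma branches_complete L vs j D C : D \subset C -> covers C C ->
  #|C|.*2 <= lp D + j -> j <= L ->
  exists r, [/\ r < 2 ^ L, 2 ^ (L - j) %| r & #|(branches (2 ^ L) vs (D, r)).1| <= #|C|].
Proof.
elim: vs j D C => [|v vs IH] j D C sDC cC Hj jL /=.
  by exists 0; rewrite expn_gt0 dvdn0 subset_leq_card.
(* Keeping the optimum is safe by persistency: [C] is exchanged for a no larger cover that contains
   the enlarged set, and no guess is spent. *)
have [eq1|ne1] := eqVneq (lp (v |: D)) (lp D).
  have [C' [sC' cC' leC']] := lp_persistent (subsetUr [set v] D) eq1 sDC cC.
  have [|r [rL dr le]] := IH j _ _ sC' cC' _ jL; first by lia.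
  by exists r; split=> //; apply: leq_trans le leC'.
have [eq0|ne0] := eqVneq (lp (D :|: nbrs v)) (lp D).
  have [C' [sC' cC' leC']] := lp_persistent (subsetUl D (nbrs v)) eq0 sDC cC.
  have [|r [rL dr le]] := IH j _ _ sC' cC' _ jL; first by lia.
  by exists r; split=> //; apply: leq_trans le leC'.
have lt1 : lp D < lp (v |: D) by rewrite ltn_neqAle eq_sym ne1 lp_mono ?subsetUr.
have lt0 : lp D < lp (D :|: nbrs v) by rewrite ltn_neqAle eq_sym ne0 lp_mono ?subsetUl.
have [vC|vC] := boolP (v \in C).
  have sDC' : v |: D \subset C by rewrite subUset sub1set vC.
  have := lp_le_cover sDC' cC => le2.
  (* With [j = 0] the optimum could not rise, because [lp (v |: D) <= #|C|.*2 <= lp D]. *)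
  case: j => [|j] in Hj jL *; first by lia.
  have [||r [rL /dvdnP[q rq] le]] := IH j _ _ sDC' cC; try lia.
  have E : 2 ^ (L - j) = 2 ^ (L - j.+1) * 2 by rewrite -expnSr; congr (_ ^ _); lia.
  have EL : 2 ^ L = 2 ^ (L - j.+1) * 2 ^ j * 2 by rewrite -expnD -expnSr; congr (_ ^ _); lia.
  (* This is [(r + 2 ^ L) / 2], the guess [r] with digit 1 put in front; divisibility of [r] by
     [2 ^ (L - j)] makes the halving exact. *)
  exists (2 ^ (L - j.+1) * (q + 2 ^ j)).
  have rr : 2 ^ (L - j.+1) * (q + 2 ^ j) + 2 ^ (L - j.+1) * (q + 2 ^ j) = r + 2 ^ L.
    rewrite rq E EL; lia.
  split; [lia | by rewrite dvdn_mulr |].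
  by rewrite rr ltnNge leq_addl /= addnK.
have sNC : D :|: nbrs v \subset C.
  rewrite subUset sDC; apply/subsetP => u; rewrite inE => evu.
  by have := (coversP _ _ cC) _ _ evu; rewrite (negbTE vC).
have := lp_le_cover sNC cC => le2.
case: j => [|j] in Hj jL *; first by lia.
have [||r [rL /dvdnP[q rq] le]] := IH j _ _ sNC cC; try lia.
have E : 2 ^ (L - j) = 2 ^ (L - j.+1) * 2 by rewrite -expnSr; congr (_ ^ _); lia.
(* This is [r / 2], the guess [r] with digit 0 put in front, which selects the neighbours. *)
exists (2 ^ (L - j.+1) * q).
have rr : 2 ^ (L - j.+1) * q + 2 ^ (L - j.+1) * q = r by rewrite rq E; lia.
by split; [lia | rewrite dvdn_mulr | rewrite rr rL].
Qed.

End DoubleCover.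

(** * Auctions *)

Section Auction.
Variables (T : finType) (e : rel T) (D : {set T}) (cap : nat).
Implicit Types (p : T -> nat) (M : rel T) (u v w : T).

(** Each vertex acts both as a bidder and as an item. Vertices of [D] take no part, since both their
    copies are forced into the double cover. *)
Definition live u v := [&& e u v, u \notin D & v \notin D].

(* [M u v] means that the bidder u currently holds the item v, of price p v. *)
Record auction_inv p M : Prop := AuctionInv {
  inv_live : forall u v, M u v -> live u v;
  inv_sold : forall u v, M u v -> 0 < p v;
  inv_happy : forall u v w, M u v -> live u w -> p v <= (p w).+1;
  inv_held : forall v, 0 < p v -> exists u, M u v;
  inv_owner : forall u u' v, M u v -> M u' v -> u = u';
  inv_item : forall u v v', M u v -> M u v' -> v = v';
  inv_cap : forall v, p v <= cap }.

Definition content p M u := (exists v, M u v) \/ (forall w, live u w -> cap <= p w).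

(** The bidder chose a cheapest item, so after the increment it pays at most 1 above its minimum.
    For the other holders the price of their own item is unchanged and the alternatives only get
    dearer. The former holder of [v] is dropped from [M']. *)
Lemma auction_bid p M p' M' u v : auction_inv p M ->
  (forall w, ~ M u w) -> live u v -> p v < cap -> (forall w, live u w -> p v <= p w) ->
  (forall w, p' w = if w == v then (p v).+1 else p w) ->
  (forall x w, M' x w = if w == v then x == u else M x w) ->
  auction_inv p' M'.
Proof.
move=> [i1 i2 i3 i4 i5 i6 i7] free luv ltv minv Ep EM; split.
- by move=> x w; rewrite EM; case: eqP => [-> /eqP->|_ /i1].
- by move=> x w; rewrite EM Ep; case: eqP => [|_ /i2].
- move=> x w w'; rewrite EM !Ep; case: (w =P v) => _.
    by move=> /eqP-> /minv; case: (w' =P v) => [->|_]; lia.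
  by move=> Mxw /(i3 _ _ _ Mxw); case: (w' =P v) => [->|_]; lia.
- move=> w; rewrite Ep; case: eqP => [->|nwv /i4[x Mx]].
    by exists u; rewrite EM !eqxx.
  by exists x; rewrite EM; case: eqP nwv.
- move=> x x' w; rewrite !EM; case: eqP => [_ /eqP-> /eqP->|_] //; exact: i5.
- move=> x w w'; rewrite !EM; case: eqP => [->|_].
    by move/eqP->; case: eqP => [->|_ /free].
  by move=> Mxw; case: eqP => [_ /eqP xu|_]; [case: (free w); rewrite -xu | exact: i6 Mxw].
- by move=> w; rewrite Ep; case: ifP.
Qed.

(** Picking one related [v] for each [u] turns [R] into a function, which the second hypothesis
    makes injective on [A]. *)
Lemma card_le_rel (A B : {set T}) (R : rel T) :
  (forall u, u \in A -> exists2 v, v \in B & R u v) ->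
  (forall u u' v, R u v -> R u' v -> u = u') -> #|A| <= #|B|.
Proof.
move=> AB injR; pose f u := odflt u [pick v in B | R u v].
have fP u : u \in A -> (f u \in B) && R u (f u).
  move=> /AB[v vB Ruv]; rewrite /f; case: pickP => //= /(_ v).
  by rewrite vB Ruv.
rewrite -(card_in_imset (f := f)) => [|u u' /fP/andP[_ h] /fP/andP[_ h'] eqf].
  apply: subset_leq_card; apply/subsetP => _ /imsetP[u /fP/andP[h _] ->]; exact: h.
by rewrite eqf in h; apply: injR h h'.
Qed.

(** Pigeonhole: there are [cap] positive levels and fewer items than that. *)
Lemma price_gap p : #|T| < cap -> exists l, [/\ 0 < l, l <= cap & forall v, p v != l].
Proof.
move=> ltcap.
have [/allP sub|/allPn[l]] := boolP (all [in map p (enum T)] (iota 1 cap)).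
  by have := uniq_leq_size (iota_uniq 1 cap) sub; rewrite size_iota size_map -cardT leqNgt ltcap.
rewrite mem_iota => lcap nol; exists l; split; try lia.
by move=> v; apply: contra nol => /eqP<-; apply/mapP; exists v; rewrite ?mem_enum.
Qed.

(* A price level l that no item has splits the items into dear and cheap ones;
   the dear items and the bidders with a cheap item in reach cover all edges,
   and each of them is matched, by pairwise different pairs. *)
Lemma auction_lp p M : #|T| < cap -> auction_inv p M -> (forall u, content p M u) ->
  lp e D = \sum_v (if v \in D then 2 else nat_of_bool (0 < p v)).
Proof.
move=> ltcap [i1 i2 i3 i4 i5 i6 i7] sat.
(* The sold items outside [D]; their number is the size of the matching [M]. *)
pose P := [set v | (v \notin D) && (0 < p v)].
have -> : \sum_v (if v \in D then 2 else nat_of_bool (0 < p v)) = #|D| + #|D| + #|P|.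
  rewrite (bigID [in D]) /=; congr (_ + _).
    rewrite (eq_bigr (fun=> 2)) => [|v /= ->] //.
    by rewrite sum_nat_const; lia.
  rewrite -sum1_card big_mkcond [RHS]big_mkcond /=; apply: eq_bigr => v _.
  by rewrite inE; case: (v \in D); case: (0 < p v).
apply/eqP; rewrite eqn_leq; apply/andP; split.
  (* Upper bound: the gap level yields a double cover of at most the required size. *)
  have [l [l0 lcap gap]] := price_gap p ltcap.
  pose XD := [set u | [exists w, live u w && (p w <= l)]].
  pose YD := [set v | (v \notin D) && (l < p v)].
  have dXY : double_cover e D (D :|: XD, D :|: YD).
    apply/and3P; split; rewrite ?subsetUl //; apply/coversP => u v euv /=.
    rewrite !inE; have [//|uD] := boolP (u \in D); have [//|vD] := boolP (v \in D).
      by rewrite orbT.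
    case: ltnP => [_|lev]; rewrite /= ?orbT // orbF; apply/existsP; exists v.
    by rewrite /live euv uD vD.
  apply: leq_trans (lp_min dXY) _.
  pose QD := [set v in P | p v <= l].
  (* Such a bidder reaches a price strictly below [l], hence below the cap, so it has not given up.
     It holds an item costing at most 1 more, which is still at most [l]. *)
  have leX : #|XD| <= #|QD|.
    apply: (@card_le_rel _ _ M) => // u; rewrite inE => /existsP[w /andP[luw pw]].
    have [[v Muv]|/(_ w luw)] := sat u; last by have := gap w; lia.
    exists v => //; rewrite !inE (i2 _ _ Muv).
    have := i1 _ _ Muv; rewrite /live => /and3P[_ _ ->] /=.
    by have := i3 _ _ _ Muv luw; have := gap w; have := gap v; lia.
  have leP : #|QD| + #|YD| <= #|P|.
    rewrite -cardsUI (_ : QD :&: YD = set0) ?cards0 ?addn0.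
      apply: subset_leq_card; apply/subsetP => v; rewrite !inE; lia.
    by apply/setP => v; rewrite !inE; lia.
  by have := (leq_card_setU D XD).1; have := (leq_card_setU D YD).1; lia.
(* Lower bound by weak duality: a sold item missing from [Y] forces its holder into [X], so every
   matched pair is paid for outside [D]. *)
have [X [Y [/and3P[/= sX sY /coversP cXY] <-]]] := lp_attained e D.
have leX : #|P :\: Y| <= #|X :\: D|.
  apply: (@card_le_rel _ _ (fun v u => M u v)) => [v|u u' v]; last exact: i6.
  rewrite !inE => /and3P[vY vD /i4[u Muv]]; exists u => //.
  have := i1 _ _ Muv; rewrite /live => /and3P[euv uD _].
  by rewrite inE uD; have := cXY _ _ euv; rewrite (negbTE vY) orbF.
have leY : #|P :&: Y| <= #|Y :\: D|.
  by apply: subset_leq_card; apply/subsetP => v; rewrite !inE => /andP[/andP[-> _] ->].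
have := cardsID Y P; have := cardsID D X; have := cardsID D Y.
by rewrite (setIidPr sX) (setIidPr sY); lia.
Qed.

End Auction.

(** * Weakest preconditions with running times *)

(** Total correctness, with the running time as an argument of the postcondition so that results and
    costs are proved together. *)
Definition wp (c : cmd) (s : state) (Q : nat -> state -> Prop) : Prop :=
  exists t s', exec c s t s' /\ Q t s'.

Fixpoint var_writes (c : cmd) : seq nat :=
  match c with
  | Skip | Write _ _ _ => [::]
  | Assign x _ => [:: x]
  | Seq c1 c2 | If _ c1 c2 => var_writes c1 ++ var_writes c2
  | While _ c => var_writes c
  end.

Fixpoint mem_writes (c : cmd) : seq nat :=
  match c with
  | Skip | Assign _ _ => [::]
  | Write a _ _ => [:: a]
  | Seq c1 c2 | If _ c1 c2 => mem_writes c1 ++ mem_writes c2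
  | While _ c => mem_writes c
  end.

(** Bounds the effect of a command by its syntax. [wp_conseq] and [wp_for] hand it to the rest of
    the proof, so specifications and loop invariants list only what changes. *)
Record frame (c : cmd) (s s' : state) : Prop := Frame {
  frame_var : forall x, x \notin var_writes c -> vars s' x = vars s x;
  frame_mem : forall a, a \notin mem_writes c -> mem s' a = mem s a }.

Lemma exec_frame c s t s' : exec c s t s' -> frame c s s'.
Proof.
elim=> //=.
- move=> {}s x e; split=> //= y; rewrite inE => /negbTE ne; by rewrite ne.
- move=> {}s a e1 e2; split=> //= b; rewrite inE => /negbTE ne; by rewrite ne.
- move=> c1 c2 s1 s2 s3 t1 t2 _ [v1 m1] _ [v2 m2]; split=> x;
    rewrite mem_cat negb_or => /andP[h1 h2]; by rewrite ?v2 ?v1 ?m2 ?m1.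
- move=> b c1 c2 {}s {}t {}s' _ _ [v1 m1]; split=> x;
    rewrite mem_cat negb_or => /andP[h1 h2]; by rewrite ?v1 ?m1.
- move=> b c1 c2 {}s {}t {}s' _ _ [v1 m1]; split=> x;
    rewrite mem_cat negb_or => /andP[h1 h2]; by rewrite ?v1 ?m1.
- move=> b {}c s1 s2 s3 t1 t2 _ _ [v1 m1] _ [/= v2 m2]; split=> x h;
    by rewrite ?v2 ?v1 ?m2 ?m1.
Qed.

Lemma wp_conseq c s (Q Q' : nat -> state -> Prop) : wp c s Q ->
  (forall t s', frame c s s' -> Q t s' -> Q' t s') -> wp c s Q'.
Proof. by move=> [t [s' [ex q]]] h; exists t, s'; split=> //; apply: h (exec_frame ex) q. Qed.

Lemma wp_skip s (Q : nat -> state -> Prop) : Q 1 s -> wp Skip s Q.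
Proof. by move=> q; exists 1, s; split=> //; constructor. Qed.

Lemma wp_assign x e s (Q : nat -> state -> Prop) :
  Q 1 (set_var s x (eval s e)) -> wp (Assign x e) s Q.
Proof. by move=> q; eexists _, _; split; first by constructor. Qed.

Lemma wp_write a e1 e2 s (Q : nat -> state -> Prop) :
  Q 1 (set_mem s a (eval s e1) (eval s e2)) -> wp (Write a e1 e2) s Q.
Proof. by move=> q; eexists _, _; split; first by constructor. Qed.

Lemma wp_seq c1 c2 s (Q : nat -> state -> Prop) :
  wp c1 s (fun t1 s1 => wp c2 s1 (fun t2 s2 => Q (t1 + t2) s2)) -> wp (Seq c1 c2) s Q.
Proof.
move=> [t1 [s1 [ex1 [t2 [s2 [ex2 q]]]]]]; exists (t1 + t2), s2; split=> //.
exact: ExSeq ex1 ex2.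
Qed.

Lemma wp_if b c1 c2 s (Q : nat -> state -> Prop) :
  (eval s b != 0 -> wp c1 s (fun t => Q t.+1)) ->
  (eval s b = 0 -> wp c2 s (fun t => Q t.+1)) -> wp (If b c1 c2) s Q.
Proof.
move=> h1 h2; case: (eqVneq (eval s b) 0) => [h|h].
  by have [t [s' [ex q]]] := h2 h; exists t.+1, s'; split=> //; apply: ExIfF.
by have [t [s' [ex q]]] := h1 h; exists t.+1, s'; split=> //; apply: ExIfT.
Qed.

Definition For (x y : nat) (body : cmd) : cmd :=
  Seq (Assign x (Const 0))
      (While (Lt (Var x) (Var y)) (Seq body (Assign x (Add (Var x) (Const 1))))).

(** A round costs at most [T], plus one step for the increment and one for the test; the initial
    assignment and the last test fit into one further round, hence [N.+1]. The counter is
    incremented after the body, so [I] must be stable under writes to it. *)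
Lemma wp_for (I : nat -> state -> Prop) (N T : nat) x y body s (Q : nat -> state -> Prop) :
  vars s y = N -> [&& x != y, x \notin var_writes body & y \notin var_writes body] ->
  (forall i s' v, I i s' -> I i (set_var s' x v)) ->
  I 0 s ->
  (forall i s', i < N -> vars s' x = i -> frame (For x y body) s s' -> I i s' ->
     wp body s' (fun t s'' => t <= T /\ I i.+1 s'')) ->
  (forall t s', t <= (T + 2) * N.+1 -> frame (For x y body) s s' -> I N s' -> Q t s') ->
  wp (For x y body) s Q.
Proof.
move=> sy /and3P[xy xb yb] Iset I0 step done_.
suff [t [s' [ex [le_t Is']]]] : wp (For x y body) s (fun t s' => t <= (T + 2) * N.+1 /\ I N s').
  by exists t, s'; split=> //; apply: done_ le_t (exec_frame ex) Is'.
pose loop := While (Lt (Var x) (Var y)) (Seq body (Assign x (Add (Var x) (Const 1)))).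
(* Here [j] counts the rounds still to run, and the induction is on [j]. *)
suff loopP j i s1 : i + j = N -> vars s1 x = i -> frame (For x y body) s s1 -> I i s1 ->
    wp loop s1 (fun t s' => t <= (T + 2) * j + 1 /\ I N s').
  apply: wp_seq; apply: wp_assign => /=.
  have [||||t [s' [ex [le_t Is']]]] := loopP N 0 (set_var s x 0).
  - by [].
  - by rewrite /= eqxx.
  - split=> //= z; rewrite inE negb_or => /andP[/negbTE zx _]; by rewrite zx.
  - exact: Iset.
  by exists t, s'; split=> //; split=> //; lia.
elim: j i s1 => [|j IH] i s1 ij s1x fr Is.
  exists 1, s1; split; first apply: ExWhileF => /=.
    have -> : vars s1 y = N.
      by rewrite (frame_var fr) // !inE mem_cat !inE !negb_or eq_sym xy yb.
    by rewrite s1x; lia.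
  by split; [lia | have <- : i = N by lia].
have s1y : vars s1 y = N.
  by rewrite (frame_var fr) // !inE mem_cat !inE !negb_or eq_sym xy yb.
have [t1 [s2 [ex1 [le1 Is2]]]] := step i s1 ltac:(lia) s1x fr Is.
pose s3 := set_var s2 x i.+1.
have ex2 : exec (Assign x (Add (Var x) (Const 1))) s2 1 s3.
  have -> : s3 = set_var s2 x (eval s2 (Add (Var x) (Const 1))).
    by rewrite /s3 /= (frame_var (exec_frame ex1)) // s1x addn1.
  by constructor.
have ex3 := ExSeq ex1 ex2.
have [||||t' [s' [ex' [le' Is']]]] := IH i.+1 s3.
- by lia.
- by rewrite /= eqxx.
- have fr3 := exec_frame ex3; split=> z zin.
    by rewrite (frame_var fr3) ?(frame_var fr) //; move: zin; rewrite /= inE negb_or => /andP[].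
  by rewrite (frame_mem fr3) ?(frame_mem fr).
- exact: Iset.
exists (t1 + 1 + t').+1, s'; split; first by apply: ExWhileT ex3 ex'; rewrite /= s1x s1y; lia.
by split=> //; lia.
Qed.

(** * The program *)

(* Registers are named r..., arrays a... *)
Local Notation rout := 0 (only parsing).
Local Notation rn := 1 (only parsing).
Local Notation rm := 2 (only parsing).
Local Notation rB := 3 (only parsing).
Local Notation rk := 4 (only parsing).
Local Notation rarcs := 5 (only parsing).
Local Notation rcap := 6 (only parsing).
Local Notation rrounds := 7 (only parsing).
Local Notation rtop := 8 (only parsing).
Local Notation rbudget := 9 (only parsing).
Local Notation rlp := 10 (only parsing).
Local Notation rguess := 11 (only parsing).
Local Notation rlp0 := 12 (only parsing).
Local Notation rlp1 := 13 (only parsing).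
Local Notation rsize := 14 (only parsing).
Local Notation rg := 20 (only parsing).
Local Notation rv := 21 (only parsing).
Local Notation ri := 22 (only parsing).
Local Notation rround := 23 (only parsing).
Local Notation ru := 24 (only parsing).
Local Notation rj := 25 (only parsing).
Local Notation rbest := 26 (only parsing).
Local Notation ritem := 27 (only parsing).

Local Notation ainput := 0 (only parsing).
Local Notation asrc := 1 (only parsing).
Local Notation adst := 2 (only parsing).
Local Notation aquery := 3 (only parsing).
Local Notation aprice := 4 (only parsing).
Local Notation aowner := 5 (only parsing).
Local Notation acur := 6 (only parsing).

Local Notation "c1 ;; c2" := (Seq c1 c2) (at level 85, right associativity).

Definition upd (f : nat -> nat) (i v : nat) : nat -> nat := fun j => if j == i then v else f j.

Definition set_of n (f : nat -> nat) : {set 'I_n} := [set i : 'I_n | f i != 0].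
Definition price n s : 'I_n -> nat := fun v => mem s aprice v.
Arguments price : clear implicits.
(** Owners are stored shifted by one, so that 0 means that nobody holds the item. *)
Definition holds n s : rel 'I_n := fun u v => mem s aowner v == u.+1.
Arguments holds : clear implicits.

(** The data that stay fixed after setup. The number of rounds exceeds by 1 the largest possible sum
    of [n] prices, each at most [n.+1]. *)
Record ready n (e : rel 'I_n) (m2 : nat) (s : state) : Prop := Ready {
  ready_n : vars s rn = n;
  ready_arcs : vars s rarcs = m2;
  ready_cap : vars s rcap = n.+1;
  ready_rounds : vars s rrounds = (n * n.+1).+1;
  ready_arc : forall j, j < m2 ->
    exists u v : 'I_n, [/\ mem s asrc j = u, mem s adst j = v & e u v];
  ready_edge : forall u v : 'I_n, e u v ->
    exists j, [/\ j < m2, mem s asrc j = u & mem s adst j = v] }.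

Definition preserves_ready (c : cmd) :=
  all (fun x => x \notin var_writes c) [:: rn; rarcs; rcap; rrounds] &&
  all (fun a => a \notin mem_writes c) [:: asrc; adst].

Lemma frame_ready n (e : rel 'I_n) m2 c s s' :
  preserves_ready c -> frame c s s' -> ready e m2 s -> ready e m2 s'.
Proof.
move=> /andP[/and5P[h1 h2 h3 h4 _] /and3P[h5 h6 _]] [fv fm] [r1 r2 r3 r4 r5 r6].
by split; rewrite ?fv ?fm.
Qed.

(** * Bids, sweeps and the auction *)

Definition bid : cmd :=
  Assign rbest (Var rcap) ;;
  Assign ritem (Const 0) ;;
  For rj rn
    (If (Eq (Read aowner (Var rj)) (Add (Var ru) (Const 1))) (Assign rbest (Const 0)) Skip) ;;
  For rj rarcs
    (If (Eq (Read asrc (Var rj)) (Var ru))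
       (If (Add (Read aquery (Var ru)) (Read aquery (Read adst (Var rj)))) Skip
          (If (Lt (Read aprice (Read adst (Var rj))) (Var rbest))
             (Assign ritem (Add (Read adst (Var rj)) (Const 1)) ;;
              Assign rbest (Read aprice (Read adst (Var rj))))
             Skip))
       Skip) ;;
  If (Var ritem)
    (Write aprice (Sub (Var ritem) (Const 1))
       (Add (Read aprice (Sub (Var ritem) (Const 1))) (Const 1)) ;;
     Write aowner (Sub (Var ritem) (Const 1)) (Add (Var ru) (Const 1)))
    Skip.

(** Either the bidder is content and prices and owners stay the same, or the outcome has the form
    that [auction_bid] asks for. *)
Lemma bid_spec n (e : rel 'I_n) m2 s (u : 'I_n) :
  ready e m2 s -> vars s ru = u ->
  let D := set_of n (mem s aquery) in
  wp bid s (fun t s' => t <= 10 * (n.+1 + m2.+1) /\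
    ((content e D n.+1 (price n s) (holds n s) u /\
        mem s' aprice = mem s aprice /\ mem s' aowner = mem s aowner) \/
     exists v : 'I_n,
       [/\ forall w, ~ holds n s u w, live e D u v, price n s v < n.+1,
           forall w, live e D u w -> price n s v <= price n s w &
           mem s' aprice = upd (mem s aprice) v (price n s v).+1 /\
           mem s' aowner = upd (mem s aowner) v u.+1])).
Proof.
move=> rd su D.
apply: wp_seq; apply: wp_assign; apply: wp_seq; apply: wp_assign; apply: wp_seq.
set s1 := set_var _ _ _.
have rd1 : ready e m2 s1 by case: rd.
pose owned i := has (fun v => mem s aowner v == u.+1) (iota 0 i).
(* A bidder who already holds an item searches with [rbest = 0], and no price is smaller; the others
   search below the cap. *)
pose I1 i s' := vars s' rbest = (if owned i then 0 else n.+1) /\ vars s' ritem = 0.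
apply: (wp_for (I := I1) (N := n) (T := 2)) => //.
- exact: ready_n rd.
- by split; rewrite //= (ready_cap rd).
- move=> i s' ltin si fr [Ib Ii].
  have E : owned i.+1 = owned i || (mem s aowner i == u.+1).
    by rewrite /owned -[i.+1]addn1 iotaD has_cat /= orbF.
  have [fu fo] : vars s' ru = u /\ mem s' aowner = mem s aowner.
    by rewrite (frame_var fr) // (frame_mem fr).
  apply: wp_if => /=; rewrite si fu fo addn1 => h.
    apply: wp_assign; split=> //; split=> //=; rewrite E.
    by move: h; case: (_ == u.+1) => //; rewrite orbT.
  apply: wp_skip; split=> //; split=> //; rewrite E Ib.
  by move: h; case: (_ == u.+1) => //; rewrite orbF.
move=> t1 s2 le1 fr1 [Ib Ii].
have rd2 : ready e m2 s2 by apply: frame_ready fr1 rd1.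
have [fu fo fp fq] : [/\ vars s2 ru = u, mem s2 aowner = mem s aowner,
    mem s2 aprice = mem s aprice & mem s2 aquery = mem s aquery].
  by rewrite (frame_var fr1) // !(frame_mem fr1).
set b0 := (if _ then _ else _) in Ib.
(* [b] is the least live price seen so far, cut off at [b0]; [ritem] stores the item plus 1, with 0
   for none. *)
pose I2 j s' := exists b,
  [/\ vars s' rbest = b, b <= b0,
      forall j' (w : 'I_n), j' < j -> mem s asrc j' = u -> mem s adst j' = w ->
        live e D u w -> b <= price n s w &
      (vars s' ritem = 0 /\ b = b0) \/
      exists v : 'I_n, [/\ vars s' ritem = v.+1, live e D u v, price n s v = b & b < b0]].
apply: wp_seq; apply: (wp_for (I := I2) (N := m2) (T := 5)) => //.
- exact: ready_arcs rd2.
- by exists b0; split=> //; left.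
- move=> j s' ltj sj fr [b [Eb leb minb best]].
  have rd' : ready e m2 s' by apply: frame_ready fr rd2.
  have [x [y [Ex Ey exy]]] := ready_arc rd ltj.
  have [fu' fo' fp' fq'] : [/\ vars s' ru = u, mem s' aowner = mem s aowner,
    mem s' aprice = mem s aprice & mem s' aquery = mem s aquery].
    by rewrite (frame_var fr) // !(frame_mem fr).
  have [fs fd] : mem s' asrc = mem s asrc /\ mem s' adst = mem s adst.
    by rewrite !(frame_mem fr) // !(frame_mem fr1).
  apply: wp_if => /=; rewrite sj fs fu' => h; last first.
    apply: wp_skip; split=> //; exists b; split=> // j' w; rewrite ltnS leq_eqVlt.
    by case/predU1P => [-> E|]; [rewrite E eqxx in h | exact: minb].
  have xu : x = u by apply: val_inj => /=; rewrite -Ex; lia.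
  rewrite {x}xu in Ex exy.
  apply: wp_if => /=; rewrite sj fd fu' fq' Ey => h1.
    apply: wp_skip; split=> //; exists b; split=> // j' w; rewrite ltnS leq_eqVlt.
    case/predU1P => [-> _|]; last exact: minb.
    rewrite Ey => /val_inj <-; rewrite /live !inE; lia.
  have luy : live e D u y by rewrite /live exy !inE; lia.
  apply: wp_if => /=; rewrite sj fd fp' Ey Eb => h2.
    apply: wp_seq; apply: wp_assign; apply: wp_assign => /=.
    rewrite sj fd fp' Ey; split=> //; exists (price n s y); split=> //.
    + by rewrite /price; lia.
    + move=> j' w; rewrite ltnS leq_eqVlt; case/predU1P => [-> _|].
        by rewrite Ey => /val_inj <-.
      by move=> a1 a2 a3 a4; have := minb _ _ a1 a2 a3 a4; rewrite /price; lia.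
    + by right; exists y; split=> //=; rewrite ?addn1 //; rewrite /price; lia.
  apply: wp_skip; split=> //; exists b; split=> // j' w; rewrite ltnS leq_eqVlt.
  case/predU1P => [-> _|]; last exact: minb.
  by rewrite Ey => /val_inj <-; rewrite /price; lia.
move=> t2 s3 le2 fr2 [b [Eb leb minb best]].
have [fu3 fo3 fp3] : [/\ vars s3 ru = u, mem s3 aowner = mem s aowner &
    mem s3 aprice = mem s aprice].
  by rewrite (frame_var fr2) // !(frame_mem fr2).
apply: wp_if => /= h; last first.
  apply: wp_skip; split; first by lia.
  left; split; last by split.
  case: best => [[_ bb]|[v [Ev _ _ _]]]; last by rewrite h in Ev.
  (* No live item lies below [b0]: either [b0 = 0] and an item is held, or [b0] is the cap and every
     live item has reached it. *)
  move: bb; rewrite /b0; case: ifP => [/hasP[v] |_ bb]; last first.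
    right=> w luw; have /and3P[euw _ _] := luw.
    have [j [ltj Ej1 Ej2]] := ready_edge rd euw.
    by rewrite -bb; apply: minb ltj Ej1 Ej2 luw.
  by rewrite mem_iota => /= ltv Ev _; left; exists (Ordinal ltv).
case: best => [[E _]|[v [Ev luv pv ltb]]]; first by rewrite E in h.
apply: wp_seq; apply: wp_write; apply: wp_write => /=.
split; first by lia.
right; exists v; split=> //.
(* A held item would give [b0 = 0], against [b < b0]. *)
- move=> w Huw; move: ltb; rewrite /b0.
  by have -> : owned n by apply/hasP; exists (val w) => //; rewrite mem_iota /=.
- by move: ltb; rewrite pv /b0; case: ifP.
- move=> w luw; have /and3P[euw _ _] := luw.
  have [j [ltj Ej1 Ej2]] := ready_edge rd euw.
  by rewrite pv; apply: minb ltj Ej1 Ej2 luw.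
by rewrite Ev subn1 /= fp3 fo3 fu3 !addn1.
Qed.

Definition sweep : cmd := For ru rn bid.

Definition total_price n s := \sum_(v < n) price n s v.
Arguments total_price : clear implicits.

(** The total price is the measure of progress. A bid raises it, while without bids prices and
    owners are constant, so each bidder found content is still content at the end of the sweep. *)
Lemma sweep_spec n (e : rel 'I_n) m2 s r :
  ready e m2 s -> m2 < 2 * n.+1 ^ 2 ->
  let D := set_of n (mem s aquery) in
  let calm s' := forall u, content e D n.+1 (price n s') (holds n s') u in
  auction_inv e D n.+1 (price n s) (holds n s) ->
  r <= total_price n s \/ calm s ->
  wp sweep s (fun t s' => t <= 32 * n.+1 ^ 3 /\
    auction_inv e D n.+1 (price n s') (holds n s') /\
    (r < total_price n s' \/ calm s')).
Proof.
move=> rd lem2 D calm inv0 prog0.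
pose I i s' := auction_inv e D n.+1 (price n s') (holds n s') /\
  [\/ r < total_price n s', calm s' | r <= total_price n s' /\
     forall u : 'I_n, u < i -> content e D n.+1 (price n s') (holds n s') u].
apply: (wp_for (I := I) (N := n) (T := 10 * (n.+1 + m2.+1))) => //.
- exact: ready_n rd.
- by split=> //; case: prog0 => h; [apply: Or33 | apply: Or32].
- move=> i s' ltin si fr [inv prog].
  have rd' : ready e m2 s' by apply: frame_ready fr rd.
  have fq : mem s' aquery = mem s aquery by rewrite (frame_mem fr).
  apply: wp_conseq (bid_spec (u := Ordinal ltin) rd' si) _ => t s'' _.
  rewrite fq -/D => -[le_t [[sat [Ep Eo]]|[v [free luv ltv minv [Ep Eo]]]]]; split=> //.
    have Ep' : price n s'' = price n s' by rewrite /price Ep.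
    have Eo' : holds n s'' = holds n s' by rewrite /holds Eo.
    rewrite /I /calm /total_price Ep' Eo'; split=> //.
    case: prog => [h|h|[h1 h2]]; [exact: Or31 | exact: Or32 | apply: Or33].
    split=> // u; rewrite ltnS leq_eqVlt; case/predU1P => [Eu|]; last exact: h2.
    by have -> : u = Ordinal ltin by apply: val_inj.
  have Ep' w : price n s'' w = if w == v then (price n s' v).+1 else price n s' w.
    by rewrite /price Ep.
  have Eo' x w : holds n s'' x w = if w == v then x == Ordinal ltin else holds n s' x w.
    rewrite /holds Eo /upd (val_eqE w v); case: (w == v) => //.
    by rewrite eqSS -val_eqE eq_sym.
  have lt_tot : total_price n s' < total_price n s''.
    rewrite /total_price (bigD1 v) //= [X in _ < X](bigD1 v) //= Ep' eqxx addSn ltnS.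
    by rewrite leq_add2l; apply: leq_sum => w /negbTE ne; rewrite Ep' ne.
  have inv'' := auction_bid inv free luv ltv minv Ep' Eo'.
  split=> //; case: prog => [h|h|[h1 h2]].
  + by apply: Or31; apply: leq_trans h (ltnW lt_tot).
  (* In a calm state a bidder without an item sees every live item at the cap, so this bid cannot
     occur. *)
  + case: (h (Ordinal ltin)) => [[w /free] //|/(_ v luv)]; lia.
  + by apply: Or31; apply: leq_ltn_trans h1 lt_tot.
move=> t s' le_t fr [inv prog]; split; first by move: le_t; nia.
split=> //; case: prog => [h|h|[h1 h2]]; [by left | by right | right].
by move=> u; apply: h2.
Qed.

Definition auction : cmd :=
  For ri rn (Write aprice (Var ri) (Const 0) ;; Write aowner (Var ri) (Const 0)) ;;
  For rround rrounds sweep ;;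
  Assign rlp (Const 0) ;;
  For ri rn
    (If (Read aquery (Var ri)) (Assign rlp (Add (Var rlp) (Const 2)))
       (If (Read aprice (Var ri)) (Assign rlp (Add (Var rlp) (Const 1))) Skip)).

(** Each sweep that does not end calm raises the total price, which is at most [n * n.+1]; one sweep
    more than that forces calm. The cap [n.+1] exceeds the number of vertices, so [auction_lp] reads
    the optimum off the final prices. *)
Lemma auction_spec n (e : rel 'I_n) m2 s :
  ready e m2 s -> m2 < 2 * n.+1 ^ 2 ->
  wp auction s (fun t s' => t <= 80 * n.+1 ^ 5 /\
    vars s' rlp = lp e (set_of n (mem s aquery))).
Proof.
move=> rd lem2; set D := set_of _ _.
apply: wp_seq.
pose I1 i s' := forall v, v < i -> mem s' aprice v = 0 /\ mem s' aowner v = 0.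
apply: (wp_for (I := I1) (N := n) (T := 2)) => //.
- exact: ready_n rd.
- move=> i s' ltin si fr Is; apply: wp_seq; apply: wp_write; apply: wp_write.
  split=> // v; rewrite ltnS leq_eqVlt /= si; case: eqP => //= _ /Is; by [].
move=> t1 s1 le1 fr1 zero.
have rd1 : ready e m2 s1 by apply: frame_ready fr1 rd.
have fq1 : mem s1 aquery = mem s aquery by rewrite (frame_mem fr1).
pose I2 r s' := auction_inv e D n.+1 (price n s') (holds n s') /\
  (r <= total_price n s' \/ forall u, content e D n.+1 (price n s') (holds n s') u).
apply: wp_seq; apply: (wp_for (I := I2) (N := (n * n.+1).+1) (T := 32 * n.+1 ^ 3)) => //.
- exact: ready_rounds rd1.
- split; last by left.
  have Ep (v : 'I_n) : price n s1 v = 0 by rewrite /price (zero v (ltn_ord v)).1.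
  have Eo (u v : 'I_n) : holds n s1 u v = false by rewrite /holds (zero v (ltn_ord v)).2.
  by split=> [u v|u v|u v w|v|u u' v|u v v'|v]; rewrite ?Eo ?Ep.
- move=> r s' ltr sr fr [inv prog].
  have rd' : ready e m2 s' by apply: frame_ready fr rd1.
  have fq : mem s' aquery = mem s aquery by rewrite (frame_mem fr).
  have h := sweep_spec (s := s') (r := r) rd' lem2; rewrite fq in h.
  by apply: wp_conseq (h inv prog) _ => t s'' _.
move=> t2 s2 le2 fr2 [inv prog].
have le_total : total_price n s2 <= n * n.+1.
  apply: (leq_trans (n := \sum_(v < n) n.+1)); last by rewrite sum_nat_const card_ord.
  by apply: leq_sum => v _; apply: inv_cap inv v.
have calm u : content e D n.+1 (price n s2) (holds n s2) u.
  by case: prog => [|/(_ u)] //; rewrite ltnNge le_total.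
have Elp : lp e D = _ := auction_lp _ inv calm; rewrite card_ord in Elp.
have rd2 : ready e m2 s2 by apply: frame_ready fr2 rd1.
have fq2 : mem s2 aquery = mem s aquery by rewrite (frame_mem fr2).
apply: wp_seq; apply: wp_assign.
pose f v := if mem s aquery v != 0 then 2 else nat_of_bool (0 < mem s2 aprice v).
pose I3 i s' := vars s' rlp = \sum_(0 <= v < i) f v.
apply: (wp_for (I := I3) (N := n) (T := 3)) => //.
- exact: ready_n rd2.
- by rewrite /I3 big_nil.
- move=> i s' ltin si fr Is.
  have [fq fp] : mem s' aquery = mem s aquery /\ mem s' aprice = mem s2 aprice.
    by rewrite !(frame_mem fr).
  have E : \sum_(0 <= v < i.+1) f v = \sum_(0 <= v < i) f v + f i by rewrite big_nat_recr.
  apply: wp_if => /=; rewrite si fq => h.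
    by apply: wp_assign; split=> //; rewrite /I3 /= Is E /f h.
  apply: wp_if => /=; rewrite si fp => h'.
    by apply: wp_assign; split=> //; rewrite /I3 /= Is E /f h eqxx lt0n h'.
  by apply: wp_skip; split=> //; rewrite /I3 /= Is E /f h h' addn0.
move=> t3 s3 le3 fr3 ->; split.
  have K1 : n.+1 <= n.+1 ^ 5 by rewrite -[X in X <= _]expn1 leq_pexp2l.
  have K5 : n.+1 ^ 5 = n.+1 ^ 3 * n.+1 ^ 2 by rewrite -expnD.
  have K3 : 0 < n.+1 ^ 3 by rewrite expn_gt0.
  have K2 : (n * n.+1).+2 <= 2 * n.+1 ^ 2 by nia.
  have : t2 <= 34 * n.+1 ^ 3 * (2 * n.+1 ^ 2).
    by apply: leq_trans le2 _; apply: leq_mul => //; lia.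
  by rewrite -mulnA (mulnCA _ 2) -K5; lia.
rewrite Elp // big_mkord; apply: eq_bigr => v _.
by rewrite /f inE.
Qed.

(** * Branching steps and attempts *)

Definition copy a b : cmd := For ri rn (Write b (Var ri) (Read a (Var ri))).

Lemma copy_spec n a b s : a != b -> vars s rn = n ->
  wp (copy a b) s (fun t s' => t <= 3 * n.+1 /\ set_of n (mem s' b) = set_of n (mem s a)).
Proof.
move=> ab sn; pose I i s' := forall v, v < i -> mem s' b v = mem s a v.
apply: (wp_for (I := I) (N := n) (T := 1)) => //.
  move=> i s' ltin si fr Is; apply: wp_write; split=> // v; rewrite ltnS leq_eqVlt /= si eqxx.
  have -> : mem s' a = mem s a by rewrite (frame_mem fr) // !inE.
  by case: eqP => [->|_ /Is].
by move=> t s' le_t _ Is; split=> //; apply/setP => v; rewrite !inE Is.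
Qed.

Definition add_nbrs : cmd :=
  For ri rarcs
    (If (Eq (Read asrc (Var ri)) (Var rv)) (Write aquery (Read adst (Var ri)) (Const 1)) Skip).

Lemma add_nbrs_spec n (e : rel 'I_n) m2 s (v : 'I_n) : ready e m2 s -> vars s rv = v ->
  wp add_nbrs s (fun t s' => t <= 4 * m2.+1 /\
    set_of n (mem s' aquery) = set_of n (mem s aquery) :|: nbrs e v).
Proof.
move=> rd sv.
pose hit w j := (mem s asrc j == v) && (mem s adst j == w).
pose I i s' := forall w, (mem s' aquery w != 0) = (mem s aquery w != 0) || has (hit w) (iota 0 i).
apply: (wp_for (I := I) (N := m2) (T := 2)) => //.
- exact: ready_arcs rd.
- by move=> w; rewrite orbF.
- move=> i s' ltin si fr Is.
  have [fv fs fd] : [/\ vars s' rv = v, mem s' asrc = mem s asrc & mem s' adst = mem s adst].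
    by rewrite (frame_var fr) // !(frame_mem fr).
  have E w : has (hit w) (iota 0 i.+1) = has (hit w) (iota 0 i) || hit w i.
    by rewrite -[i.+1]addn1 iotaD has_cat /= orbF.
  apply: wp_if => /=; rewrite si fv fs => h.
    apply: wp_write; split=> // w; rewrite E /= si fd /hit.
    have -> /= : mem s asrc i == v by case: (mem s asrc i == v) h.
    by rewrite [w == _]eq_sym; case: (_ == w); rewrite ?orbT // orbF Is.
  apply: wp_skip; split=> // w; rewrite E Is /hit.
  by case: (mem s asrc i == v) h => //; rewrite orbF.
move=> t s' le_t _ Is; split=> //; apply/setP => w; rewrite !inE Is; congr (_ || _).
apply/hasP/idP => [[j]|evw].
  rewrite mem_iota => /= ltj /andP[/eqP h1 /eqP h2].
  have [x [y [Ex Ey exy]]] := ready_arc rd ltj.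
  have -> : v = x by apply: val_inj; rewrite /= -h1 Ex.
  by have -> : w = y by apply: val_inj; rewrite /= -h2 Ey.
have [j [ltj Ej1 Ej2]] := ready_edge rd evw.
by exists j; rewrite ?mem_iota // /hit Ej1 Ej2 !eqxx.
Qed.

(** [acur] holds the partial cover, and [aquery] the candidate on which the auction is run. The
    candidate is copied back only when the neighbours are chosen. *)
Definition branching : cmd :=
  copy acur aquery ;; auction ;; Assign rlp0 (Var rlp) ;;
  Write aquery (Var rv) (Const 1) ;; auction ;; Assign rlp1 (Var rlp) ;;
  If (Eq (Var rlp1) (Var rlp0)) (Write acur (Var rv) (Const 1))
    (copy acur aquery ;; add_nbrs ;; auction ;; Assign rlp1 (Var rlp) ;;
     If (Eq (Var rlp1) (Var rlp0)) (copy aquery acur)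
       (Assign rguess (Add (Var rguess) (Var rguess)) ;;
        If (Lt (Var rguess) (Var rtop)) (copy aquery acur)
          (Assign rguess (Sub (Var rguess) (Var rtop)) ;;
           Write acur (Var rv) (Const 1)))).

Lemma set_of_upd n f (v : 'I_n) : set_of n (upd f v 1) = v |: set_of n f.
Proof. by apply/setP => w; rewrite !inE /upd (val_eqE w v); case: (w == v). Qed.

Lemma branching_spec n (e : rel 'I_n) m2 s (v : 'I_n) :
  ready e m2 s -> m2 < 2 * n.+1 ^ 2 -> vars s rv = v ->
  wp branching s (fun t s' => t <= 300 * n.+1 ^ 5 /\
    (set_of n (mem s' acur), vars s' rguess) =
      branch e (vars s rtop) v (set_of n (mem s acur), vars s rguess)).
Proof.
move=> rd lem2 sv; set D := set_of n (mem s acur).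
have K1 : n.+1 <= n.+1 ^ 5 by rewrite -[X in X <= _]expn1 leq_pexp2l.
have K2 : n.+1 ^ 2 <= n.+1 ^ 5 by rewrite leq_pexp2l.
apply: wp_seq; apply: wp_conseq (copy_spec _ (ready_n rd)) _ => // t1 s1 fr1 [le1 Q1].
have rd1 : ready e m2 s1 by apply: frame_ready fr1 rd.
apply: wp_seq; apply: wp_conseq (auction_spec rd1 lem2) _ => t2 s2 fr2 [le2 L2].
have rd2 : ready e m2 s2 by apply: frame_ready fr2 rd1.
rewrite Q1 -/D in L2.
apply: wp_seq; apply: wp_assign; apply: wp_seq; apply: wp_write.
set s3 := set_mem _ _ _ _; rewrite [eval s2 _]L2 in s3 *.
have rd3 : ready e m2 s3 by case: rd2.
have sv2 : vars s2 rv = v by rewrite (frame_var fr2) // (frame_var fr1).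
have Q3 : set_of n (mem s3 aquery) = v |: D.
  rewrite (_ : mem s3 aquery = upd (mem s2 aquery) v 1); last by rewrite -sv2.
  by rewrite set_of_upd (frame_mem fr2) // Q1.
apply: wp_seq; apply: wp_conseq (auction_spec rd3 lem2) _ => t4 s4 fr4 [le4 L4].
have rd4 : ready e m2 s4 by apply: frame_ready fr4 rd3.
rewrite Q3 in L4.
apply: wp_seq; apply: wp_assign; rewrite [eval s4 _]L4.
have L0 : vars s4 rlp0 = lp e D by rewrite (frame_var fr4).
have sv4 : vars s4 rv = v by rewrite (frame_var fr4).
have C4 : mem s4 acur = mem s acur.
  by rewrite (frame_mem fr4) //= (frame_mem fr2) // (frame_mem fr1).
have G4 : vars s4 rguess = vars s rguess.
  by rewrite (frame_var fr4) //= (frame_var fr2) // (frame_var fr1).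
have T4 : vars s4 rtop = vars s rtop.
  by rewrite (frame_var fr4) //= (frame_var fr2) // (frame_var fr1).
rewrite /branch; apply: wp_if => /=; rewrite L0; have [E1|E1] //= := eqVneq (lp e (v |: D)) (lp e D) => _.
  apply: wp_write; split; first by lia.
  rewrite /= sv4 C4 G4; congr (_, _); exact: set_of_upd.
set s5 := set_var s4 rlp1 _.
have rd5 : ready e m2 s5 by case: rd4.
apply: wp_seq; apply: wp_conseq (copy_spec _ (ready_n rd5)) _ => // t6 s6 fr6 [le6 Q6].
have rd6 : ready e m2 s6 by apply: frame_ready fr6 rd5.
have sv6 : vars s6 rv = v by rewrite (frame_var fr6).
rewrite /= C4 -/D in Q6.
apply: wp_seq; apply: wp_conseq (add_nbrs_spec rd6 sv6) _ => // t7 s7 fr7 [le7 Q7].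
have rd7 : ready e m2 s7 by apply: frame_ready fr7 rd6.
rewrite Q6 in Q7.
apply: wp_seq; apply: wp_conseq (auction_spec rd7 lem2) _ => t8 s8 fr8 [le8 L8].
have rd8 : ready e m2 s8 by apply: frame_ready fr8 rd7.
rewrite Q7 in L8.
have Q8 : set_of n (mem s8 aquery) = D :|: nbrs e v by rewrite (frame_mem fr8).
have L08 : vars s8 rlp0 = lp e D.
  by rewrite (frame_var fr8) // (frame_var fr7) // (frame_var fr6).
have sv8 : vars s8 rv = v by rewrite (frame_var fr8) // (frame_var fr7).
have C8 : mem s8 acur = mem s acur.
  by rewrite (frame_mem fr8) // (frame_mem fr7) // (frame_mem fr6).
have G8 : vars s8 rguess = vars s rguess.
  by rewrite (frame_var fr8) // (frame_var fr7) // (frame_var fr6).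
have T8 : vars s8 rtop = vars s rtop.
  by rewrite (frame_var fr8) // (frame_var fr7) // (frame_var fr6).
apply: wp_seq; apply: wp_assign; rewrite [eval s8 _]L8.
apply: wp_if => /=; rewrite L08; have [E2|E2] //= := eqVneq (lp e (D :|: nbrs e v)) (lp e D) => _.
  set s9 := set_var s8 _ _; have rd9 : ready e m2 s9 by case: rd8.
  apply: wp_conseq (copy_spec _ (ready_n rd9)) _ => // t10 s10 fr10 [le10 Q10].
  split; first by lia.
  by rewrite Q10 (frame_var fr10) //= Q8 G8.
apply: wp_seq; apply: wp_assign => /=; rewrite G8.
apply: wp_if => /=; rewrite T8; case: ltnP => //= _ _.
  set s9 := set_var _ _ _; have rd9 : ready e m2 s9 by case: rd8.
  apply: wp_conseq (copy_spec _ (ready_n rd9)) _ => // t10 s10 fr10 [le10 Q10].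
  split; first by lia.
  by rewrite Q10 (frame_var fr10) //= Q8.
apply: wp_seq; apply: wp_assign; apply: wp_write; split; first by lia.
rewrite /= sv8 C8 T8; congr (_, _); exact: set_of_upd.
Qed.

(** The machine has no multiplication, so the size is accumulated in units of [B] and compared with
    [m + k * B]. The output register is only ever raised to 1, so successive attempts form a
    disjunction. *)
Definition attempt : cmd :=
  For ri rn (Write acur (Var ri) (Const 0)) ;;
  Assign rguess (Var rg) ;;
  For rv rn branching ;;
  Assign rsize (Const 0) ;;
  For ri rn (If (Read acur (Var ri)) (Assign rsize (Add (Var rsize) (Var rB))) Skip) ;;
  If (Lt (Var rbudget) (Var rsize)) Skip (Assign rout (Const 1)).

Definition accepts n (e : rel 'I_n) top B budget g :=
  #|(branches e top (enum 'I_n) (set0, g)).1| * B <= budget.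

Lemma attempt_spec n (e : rel 'I_n) m2 s :
  ready e m2 s -> m2 < 2 * n.+1 ^ 2 ->
  wp attempt s (fun t s' => t <= 320 * n.+1 ^ 6 /\
    vars s' rout = if accepts e (vars s rtop) (vars s rB) (vars s rbudget) (vars s rg)
                   then 1 else vars s rout).
Proof.
move=> rd lem2.
pose I1 i s' := forall v, v < i -> mem s' acur v = 0.
apply: wp_seq; apply: (wp_for (I := I1) (N := n) (T := 1)) => //.
- exact: ready_n rd.
- move=> i s' ltin si fr Is; apply: wp_write; split=> // v; rewrite ltnS leq_eqVlt /= si.
  by case: eqP => //= _ /Is.
move=> t1 s1 le1 fr1 zero.
have D0 : set_of n (mem s1 acur) = set0 by apply/setP => v; rewrite !inE zero.
apply: wp_seq; apply: wp_assign; rewrite [eval s1 _](frame_var fr1) //.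
set s2 := set_var _ _ _.
have rd2 : ready e m2 s2 by case: (frame_ready _ fr1 rd).
have T2 : vars s2 rtop = vars s rtop by rewrite /= (frame_var fr1).
pose I2 i s' := (set_of n (mem s' acur), vars s' rguess) =
  branches e (vars s rtop) (take i (enum 'I_n)) (set0, vars s rg).
apply: wp_seq; apply: (wp_for (I := I2) (N := n) (T := 300 * n.+1 ^ 5)) => //.
- exact: ready_n rd2.
- by rewrite /I2 take0 /= D0.
- move=> i s' ltin si fr Is.
  have rd' : ready e m2 s' by apply: frame_ready fr rd2.
  apply: wp_conseq (branching_spec (v := Ordinal ltin) rd' lem2 si) _ => t s'' _ [le_t E].
  split=> //; rewrite /I2 E (frame_var fr) // T2 Is.
  rewrite (take_nth (Ordinal ltin)) ?size_enum_ord // /branches -cats1 foldl_cat /=.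
  by rewrite -[X in nth _ _ X]/(val (Ordinal ltin)) nth_ord_enum.
move=> t3 s3 le3 fr3; rewrite /I2 take_oversize ?size_enum_ord // => D3.
have rd3 : ready e m2 s3 by apply: frame_ready fr3 rd2.
apply: wp_seq; apply: wp_assign; set s4 := set_var _ _ _.
pose f v := (mem s3 acur v != 0) * vars s rB.
pose I4 i s' := vars s' rsize = \sum_(0 <= v < i) f v.
apply: wp_seq; apply: (wp_for (I := I4) (N := n) (T := 2)) => //.
- exact: ready_n rd3.
- by rewrite /I4 big_nil.
- move=> i s' ltin si fr Is.
  have E : \sum_(0 <= v < i.+1) f v = \sum_(0 <= v < i) f v + f i by rewrite big_nat_recr.
  have fc : mem s' acur = mem s3 acur by rewrite (frame_mem fr).
  have fB : vars s' rB = vars s rB.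
    by rewrite (frame_var fr) //= (frame_var fr3) //= (frame_var fr1).
  apply: wp_if => /=; rewrite si fc => h.
    by apply: wp_assign; split=> //; rewrite /I4 /= Is E /f h fB mul1n.
  by apply: wp_skip; split=> //; rewrite /I4 Is E /f h addn0.
move=> t5 s5 le5 fr5 size5.
have lt : t1 + (1 + (t3 + (1 + (t5 + 2)))) <= 320 * n.+1 ^ 6.
  have K1 : n.+1 <= n.+1 ^ 6 by rewrite -[X in X <= _]expn1 leq_pexp2l.
  have K6 : n.+1 ^ 6 = n.+1 ^ 5 * n.+1 by rewrite expnSr.
  lia.
have Esize : vars s5 rsize =
    #|(branches e (vars s rtop) (enum 'I_n) (set0, vars s rg)).1| * vars s rB.
  rewrite size5 -D3 /= big_mkord -sum1_card big_distrl /= [RHS]big_mkcond /=.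
  by apply: eq_bigr => v _; rewrite inE /f; case: (_ != 0); rewrite ?mul0n.
have [fb fo] : vars s5 rbudget = vars s rbudget /\ vars s5 rout = vars s rout.
  by rewrite !(frame_var fr5) //= !(frame_var fr3) //= !(frame_var fr1).
rewrite /accepts -Esize -fb; apply: wp_if => /= h.
  by apply: wp_skip; split; [lia | rewrite leqNgt; case: (_ < _) h].
by apply: wp_assign; split; [lia | rewrite leqNgt; case: (_ < _) h].
Qed.

(** * From edge lists to the symmetric relation, and correctness of the guesses *)

Definition edge_rel n (E : seq (nat * nat)) : rel 'I_n :=
  fun u v => ((val u, val v) \in E) || ((val v, val u) \in E).
Arguments edge_rel : clear implicits.

Lemma edge_rel_sym n E : symmetric (edge_rel n E).
Proof. by move=> u v; rewrite /edge_rel orbC. Qed.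

Lemma uniq_map_inj_in (T1 T2 : eqType) (f : T1 -> T2) (r : seq T1) :
  uniq (map f r) -> {in r &, injective f}.
Proof.
elim: r => //= a r IH /andP[na ur] x y; rewrite !inE.
case/predU1P => [->|xr] /predU1P[->|yr] // eqf; last exact: IH eqf.
  by case/negP: na; rewrite eqf map_f.
by case/negP: na; rewrite -eqf map_f.
Qed.

Lemma simple_graphP n E : simple_graph n E ->
  (forall x, x \in E -> [/\ x.1 < n, x.2 < n & x.1 != x.2]) /\
  uniq [seq (minn x.1 x.2, maxn x.1 x.2) | x <- E].
Proof. by case/andP => /allP h ->; split=> // x /h/and3P[]. Qed.

(** Sorting the endpoints sends the edges to distinct pairs in an [n] by [n] grid. *)
Lemma simple_size n E : simple_graph n E -> size E <= n * n.
Proof.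
case/simple_graphP => ltE uE.
pose V := iota 0 n; have -> : n * n = size [seq (u, v) | u <- V, v <- V].
  by rewrite size_allpairs size_iota.
rewrite -(size_map (fun x => (minn x.1 x.2, maxn x.1 x.2))); apply: uniq_leq_size => // y.
case/mapP => x /ltE[lt1 lt2 _] ->; apply/allpairsP.
by exists (minn x.1 x.2, maxn x.1 x.2); rewrite !mem_iota /= add0n gtn_min gtn_max lt1 lt2.
Qed.

(** The edges and their reversals together form a list of arcs without repetition. *)
Lemma card_arcs n E : simple_graph n E ->
  size E + size E <= #|[set a : 'I_n * 'I_n | edge_rel n E a.1 a.2]|.
Proof.
move=> /simple_graphP[ltE uE]; set A := finset _.
pose swap (x : nat * nat) := (x.2, x.1).
have uE' : uniq E by apply: map_uniq uE.
have uL : uniq (E ++ map swap E).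
  rewrite cat_uniq uE' map_inj_uniq ?uE' ?andbT => [|[a b] [c d] [-> ->]] //.
  apply/hasP => -[_ /mapP[x xE ->] yE].
  have [_ _ ne] := ltE x xE.
  (* An edge and its reversal have the same sorted pair, so if both were listed they would coincide
     and [x] would be a loop. *)
  suff /(congr1 fst) /= h : swap x = x by rewrite h eqxx in ne.
  by apply: (uniq_map_inj_in uE) => //=; rewrite minnC maxnC.
have -> : size E + size E = size (E ++ map swap E) by rewrite size_cat size_map.
rewrite cardE -(size_map (fun a : 'I_n * 'I_n => (val a.1, val a.2))).
apply: uniq_leq_size => // x xL; have xE : (x \in E) || (swap x \in E).
  move: xL; rewrite mem_cat; case/orP => [->//|/mapP[y yE ->]].
  by rewrite {2}/swap /= -surjective_pairing yE orbT.
have [lt1 lt2] : x.1 < n /\ x.2 < n by case/orP: xE => /ltE[].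
apply/mapP; exists (Ordinal lt1, Ordinal lt2); last exact: surjective_pairing.
by rewrite mem_enum inE /edge_rel /= -surjective_pairing.
Qed.

(** Sending each edge at [u] to its other endpoint reaches all neighbours. *)
Lemma card_nbrs n E (u : 'I_n) : #|[set v | edge_rel n E u v]| <= degree E u.
Proof.
rewrite /degree -size_filter cardE -(size_map val).
rewrite -[X in _ <= X](size_map (fun x : nat * nat => if x.1 == u then x.2 else x.1)).
apply: uniq_leq_size; first by rewrite map_inj_uniq ?enum_uniq //; apply: val_inj.
move=> _ /mapP[v + ->]; rewrite mem_enum inE => /orP[h|h]; apply/mapP.
  by exists (val u, val v); rewrite ?mem_filter /= ?eqxx ?h.
exists (val v, val u); rewrite ?mem_filter /= ?eqxx ?orbT ?h //.
by case: eqP.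
Qed.

(* Spreading weight 1/B over every edge is a fractional matching. *)
Lemma lp_edge_rel n E B : simple_graph n E -> max_degree_le n E B ->
  (size E).*2 <= lp (edge_rel n E) set0 * B.
Proof.
move=> simE /allP degB.
have nbrB (u : 'I_n) : #|[set v | edge_rel n E u v]| <= B.
  by apply: leq_trans (card_nbrs E u) (degB _ _); rewrite mem_iota /=.
rewrite -addnn; apply: leq_trans (card_arcs simE) (lp_degree nbrB _) => v.
apply: leq_trans (nbrB v); apply: subset_leq_card; apply/subsetP => u.
by rewrite !inE edge_rel_sym.
Qed.

(** Soundness: every guess leads to a vertex cover, and acceptance checks its size. *)
Lemma accepts_VCL1 n E B k g : simple_graph n E ->
  accepts (edge_rel n E) (2 ^ (k + k)) B (size E + k * B) g -> VCL1 n E B k.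
Proof.
rewrite /accepts => /simple_graphP[ltE _]; set D := (branches _ _ _ _).1 => leD.
exists [seq val v | v <- enum D]; split; last by rewrite size_map -cardE.
apply/and3P; split.
- by rewrite map_inj_uniq ?enum_uniq //; apply: val_inj.
- by apply/allP => _ /mapP[v _ ->] /=; apply: ltn_ord.
apply/allP => -[a b] /[dup] abE /ltE[/= lta ltb _].
have mapE (v : 'I_n) : (val v \in [seq val v | v <- enum D]) = (v \in D).
  by rewrite mem_map ?mem_enum //; apply: val_inj.
rewrite (mapE (Ordinal lta)) (mapE (Ordinal ltb)); apply: branches_cover.
  by rewrite mem_enum.
by rewrite /edge_rel /= abE.
Qed.

(** Completeness: a cover within the budget exceeds the optimum so little that [k + k] binary
    guesses suffice to follow it. *)
Lemma VCL1_accepts n E B k : 0 < B -> simple_graph n E -> max_degree_le n E B ->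
  VCL1 n E B k ->
  exists2 g, g < 2 ^ (k + k) & accepts (edge_rel n E) (2 ^ (k + k)) B (size E + k * B) g.
Proof.
move=> B0 simE degB [C [/and3P[uC ltC /allP cC] leC]].
pose C' := [set v : 'I_n | val v \in C].
have leC' : #|C'| <= size C.
  rewrite cardE -(size_map val); apply: uniq_leq_size.
    by rewrite map_inj_uniq ?enum_uniq //; apply: val_inj.
  by move=> _ /mapP[v + ->]; rewrite mem_enum inE.
have cov : covers (edge_rel n E) C' C'.
  by apply/coversP => u v; rewrite !inE => /orP[/cC|/cC]; rewrite //= orbC.
have lpB := lp_edge_rel simE degB.
(* Doubling [#|C'| * B <= m + k * B] and using [m.*2 <= lp * B], one cancels the positive factor
   [B]. *)
have h : #|C'|.*2 <= lp (edge_rel n E) set0 + (k + k) by nia.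
have [r [ltr _ le]] :=
  branches_complete (@edge_rel_sym n E) (enum 'I_n) (sub0set C') cov h (leqnn _).
exists r => //; rewrite /accepts; apply: leq_trans leC.
by rewrite leq_mul2r (leq_trans le leC') orbT.
Qed.

(** For [B = 1] the budget is at least [m], and one endpoint of each edge is enough. *)
Lemma VCL1_degree1 n E k : simple_graph n E -> VCL1 n E 1 k.
Proof.
case/simple_graphP => ltE _; exists (undup [seq x.1 | x <- E]); split; last first.
  by rewrite !muln1 (leq_trans (size_undup _)) // size_map leq_addr.
apply/and3P; split; rewrite ?undup_uniq //; apply/allP => x.
  by rewrite mem_undup => /mapP[y /ltE[lt _ _] ->].
by move=> xE; rewrite !mem_undup map_f.
Qed.

(** * Reading the input, the search over all guesses, and the total running time *)

Lemma nth_flatten_edges E i : i < size E ->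
  nth 0 (flatten [seq [:: x.1; x.2] | x <- E]) (i + i) = (nth (0, 0) E i).1 /\
  nth 0 (flatten [seq [:: x.1; x.2] | x <- E]) (i + i).+1 = (nth (0, 0) E i).2.
Proof. by elim: E i => //= x E IH [|i] //= /IH; rewrite addnS. Qed.

(** Products and powers are built by repeated addition; [rtop] is doubled twice per round to reach
    [4 ^ k]. The edges start at input cell 4, after the four header cells; edge [i] becomes arc [i]
    and, reversed, arc [m + i]. *)
Definition setup : cmd :=
  Assign rn (Read ainput (Const 0)) ;;
  Assign rm (Read ainput (Const 1)) ;;
  Assign rB (Read ainput (Const 2)) ;;
  Assign rk (Read ainput (Const 3)) ;;
  Assign rarcs (Add (Var rm) (Var rm)) ;;
  Assign rcap (Add (Var rn) (Const 1)) ;;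
  Assign rrounds (Const 1) ;;
  Assign rtop (Const 1) ;;
  Assign rbudget (Var rm) ;;
  For ri rn (Assign rrounds (Add (Var rrounds) (Var rcap))) ;;
  For ri rk
    (Assign rbudget (Add (Var rbudget) (Var rB)) ;;
     Assign rtop (Add (Var rtop) (Var rtop)) ;;
     Assign rtop (Add (Var rtop) (Var rtop))) ;;
  For ri rm
    (Write asrc (Var ri) (Read ainput (Add (Const 4) (Add (Var ri) (Var ri)))) ;;
     Write adst (Var ri) (Read ainput (Add (Const 5) (Add (Var ri) (Var ri)))) ;;
     Write asrc (Add (Var rm) (Var ri)) (Read ainput (Add (Const 5) (Add (Var ri) (Var ri)))) ;;
     Write adst (Add (Var rm) (Var ri)) (Read ainput (Add (Const 4) (Add (Var ri) (Var ri))))).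

Lemma setup_spec n E B k : simple_graph n E ->
  wp setup (init_state n E B k) (fun t s =>
    [/\ t <= 20 * (n.+1 ^ 2 + k.+1), ready (edge_rel n E) (size E + size E) s,
        vars s rtop = 2 ^ (k + k), vars s rbudget = size E + k * B &
        vars s rB = B /\ vars s rout = 0]).
Proof.
move=> simE; have leE := simple_size simE.
do 9 (apply: wp_seq; apply: wp_assign).
set s0 := set_var _ rbudget _.
pose I1 i s := vars s rrounds = (i * n.+1).+1.
apply: wp_seq; apply: (wp_for (I := I1) (N := n) (T := 1)) => //.
  move=> i s ltin si fr Is; apply: wp_assign; split=> //; rewrite /I1 /= Is.
  by rewrite (frame_var fr) //= addn1 mulSn; lia.
move=> t1 s1 le1 fr1 R1.
pose I2 i s := vars s rtop = 2 ^ (i + i) /\ vars s rbudget = size E + i * B.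
apply: wp_seq; apply: (wp_for (I := I2) (N := k) (T := 3)) => //.
- by rewrite (frame_var fr1).
- by split; rewrite (frame_var fr1) // mul0n addn0.
- move=> i s ltin si fr [It Ib].
  do 2 (apply: wp_seq; apply: wp_assign); apply: wp_assign; split=> //; split=> /=.
    by rewrite It addSn addnS !expnS; lia.
  by rewrite Ib (frame_var fr) //= (frame_var fr1) //= mulSn; lia.
move=> t2 s2 le2 fr2 [top2 bud2].
have var2 x v : vars s0 x = v -> x \in [:: rn; rm; rB; rarcs; rcap; rout] -> vars s2 x = v.
  move=> <- xin; rewrite (frame_var fr2) ?(frame_var fr1) //;
  by move: xin; rewrite !inE; do 5 (case/orP => [/eqP->//|]); move/eqP->.
have in2 : mem s2 ainput = nth 0 (input_list n E B k).
  by rewrite (frame_mem fr2) // (frame_mem fr1).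
set m := size E.
pose I3 i s := forall j, j < i ->
  [/\ mem s asrc j = (nth (0, 0) E j).1, mem s adst j = (nth (0, 0) E j).2,
      mem s asrc (m + j) = (nth (0, 0) E j).2 & mem s adst (m + j) = (nth (0, 0) E j).1].
apply: (wp_for (I := I3) (N := m) (T := 4)) => //.
- exact: var2.
- move=> i s ltin si fr Is.
  have fm : vars s rm = m by rewrite (frame_var fr) // (var2 _ m).
  have fi : mem s ainput = nth 0 (input_list n E B k) by rewrite (frame_mem fr).
  have [N1 N2] := nth_flatten_edges ltin.
  do 3 (apply: wp_seq; apply: wp_write); apply: wp_write; split=> // j ltj.
  have e4 : mem s ainput (4 + (i + i)) = (nth (0, 0) E i).1 by rewrite fi -N1.
  have e5 : mem s ainput (5 + (i + i)) = (nth (0, 0) E i).2 by rewrite fi -N2.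
  rewrite /= si fm e4 e5.
  have -> : (j == m + i) = false by lia.
  have -> : (m + j == i) = false by lia.
  rewrite eqn_add2l; case: (j =P i) => [->//|ne].
  by apply: Is; lia.
move=> t3 s3 le3 fr3 arcs.
have var3 x v : vars s0 x = v -> x \in [:: rn; rm; rB; rarcs; rcap; rout] -> vars s3 x = v.
  move=> Ex xin; rewrite (frame_var fr3) ?(var2 x v) //.
  by move: xin; rewrite !inE; do 5 (case/orP => [/eqP->//|]); move/eqP->.
have [ltE _] := simple_graphP simE.
split.
(* The edge loop fits into the quadratic term because there are at most [n * n] edges. *)
- by rewrite /m in le3 *; nia.
- split.
  + exact: var3.
  + exact: var3.
  + by apply: var3; rewrite //= addn1.
  + by rewrite (frame_var fr3) // (frame_var fr2).
  + move=> j ltj; have [ltjm|lemj] := ltnP j m.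
      have [E1 E2 _ _] := arcs j ltjm; have inE := mem_nth (0, 0) ltjm.
      have [lt1 lt2 _] := ltE _ inE.
      exists (Ordinal lt1), (Ordinal lt2); split=> //.
      by rewrite /edge_rel /= -surjective_pairing inE.
    have ltjm : j - m < m by lia.
    have [_ _ E1 E2] := arcs _ ltjm; have inE := mem_nth (0, 0) ltjm.
    have [lt1 lt2 _] := ltE _ inE; rewrite subnKC // in E1 E2.
    exists (Ordinal lt2), (Ordinal lt1); split=> //.
    by rewrite /edge_rel /= -surjective_pairing inE orbT.
  + move=> u v /orP[] inE; have := inE; rewrite -index_mem => ltj.
      exists (index (val u, val v) E); have [-> -> _ _] := arcs _ ltj.
      by rewrite nth_index //; split=> //; apply: leq_trans ltj (leq_addr _ _).
    exists (m + index (val v, val u) E); have [_ _ -> ->] := arcs _ ltj.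
    by rewrite nth_index //; split=> //; rewrite ltn_add2l.
- by rewrite (frame_var fr3).
- by rewrite (frame_var fr3).
- by split; apply: var3.
Qed.

Definition search : cmd := For rg rtop attempt.

Lemma search_spec n (e : rel 'I_n) m2 s :
  ready e m2 s -> m2 < 2 * n.+1 ^ 2 -> vars s rout = 0 ->
  wp search s (fun t s' => t <= 322 * n.+1 ^ 6 * (vars s rtop).+1 /\
    vars s' rout =
      has (accepts e (vars s rtop) (vars s rB) (vars s rbudget)) (iota 0 (vars s rtop))).
Proof.
move=> rd lem2 out0; set acc := accepts _ _ _ _.
pose I i s' := vars s' rout = has acc (iota 0 i).
apply: (wp_for (I := I) (N := vars s rtop) (T := 320 * n.+1 ^ 6)) => //.
  move=> g s' ltg sg fr Is.
  have rd' : ready e m2 s' by apply: frame_ready fr rd.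
  have [f1 f2 f3] : [/\ vars s' rtop = vars s rtop, vars s' rB = vars s rB &
      vars s' rbudget = vars s rbudget] by rewrite !(frame_var fr).
  apply: wp_conseq (attempt_spec rd' lem2) _ => t s'' _ [le_t E]; split=> //.
  rewrite /I E sg f1 f2 f3 -/acc Is -[g.+1]addn1 iotaD has_cat /= orbF.
  by case: (acc g); rewrite ?orbT ?orbF.
move=> t s' le_t _ Is; split=> //; apply: leq_trans le_t _; rewrite leq_mul2r.
have K0 : 0 < n.+1 ^ 6 by rewrite expn_gt0.
by apply/orP; right; lia.
Qed.

Definition vcl1_program : cmd :=
  setup ;; If (Lt (Var rB) (Const 2)) (Assign rout (Const 1)) search.

Theorem theorem3 :
  exists (P : cmd) (c d : nat),
    forall (n : nat) (E : seq (nat * nat)) (B k : nat),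
      0 < B -> 0 < k -> simple_graph n E -> max_degree_le n E B ->
      exists (t : nat) (s' : state) (b : bool),
        [/\ exec P (init_state n E B k) t s',
            vars s' 0 = answer b,
            (b <-> VCL1 n E B k) &
            t <= c * 2 ^ (k * B) * n.+1 ^ d].
Proof.
(* The exponent 6 arises from [n] branching steps per attempt, each with at most three auctions of
   quadratically many sweeps of cubic cost; 1000 leaves slack. *)
exists vcl1_program, 1000, 6 => n E B k B0 k0 simE degB.
suff [t [s' [ex [b [h1 h2 h3]]]]] : wp vcl1_program (init_state n E B k) (fun t s' =>
    exists b : bool, [/\ vars s' rout = answer b, b <-> VCL1 n E B k &
      t <= 1000 * 2 ^ (k * B) * n.+1 ^ 6]).
  by exists t, s', b.
(* This pays for the setup loop, which is linear in [k]. *)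
have lekB : k < 2 ^ (k * B).
  by apply: leq_trans (ltn_expl k (isT : 1 < 2)) _; rewrite leq_exp2l // leq_pmulr.
have K2 : n.+1 ^ 2 <= n.+1 ^ 6 by rewrite leq_pexp2l.
have K0 : 0 < n.+1 ^ 6 by rewrite expn_gt0.
have a1 : n.+1 ^ 6 <= 2 ^ (k * B) * n.+1 ^ 6 by rewrite leq_pmull // expn_gt0.
have a2 : 2 ^ (k * B) <= 2 ^ (k * B) * n.+1 ^ 6 by rewrite leq_pmulr.
apply: wp_seq; apply: wp_conseq (setup_spec B k simE) _ => t1 s1 fr1 [le1 rd1 top1 bud1 [B1 out1]].
apply: wp_if => /=; rewrite B1; case: (ltnP B 2) => // ltB _.
  apply: wp_assign; exists true; split=> //; last by rewrite -mulnA; lia.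
  have -> : B = 1 by lia.
  by split=> // _; apply: VCL1_degree1.
have lem2 : size E + size E < 2 * n.+1 ^ 2 by have := simple_size simE; nia.
apply: wp_conseq (search_spec rd1 lem2 out1) _ => t2 s2 _ [le2 out2].
rewrite top1 B1 bud1 in le2 out2; set b := has _ _ in out2.
exists b; split; first by rewrite out2; case: (b).
  split=> [/hasP[g _]|]; first exact: accepts_VCL1.
  by case/(VCL1_accepts B0 simE degB) => g ltg acc; apply/hasP; exists g; rewrite ?mem_iota.
(* Here [2 <= B], so the number of guesses stays within the claimed exponential factor. *)
have le4 : 2 ^ (k + k) <= 2 ^ (k * B) by rewrite leq_exp2l // addnn -muln2 leq_mul2l ltB orbT.
have a3 : n.+1 ^ 6 * (2 ^ (k + k)).+1 <= n.+1 ^ 6 * (2 ^ (k * B) * 2) by rewrite leq_mul2l; lia.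
rewrite mulnA (mulnC (n.+1 ^ 6)) in a3; rewrite -mulnA in le2; rewrite -mulnA; lia.
Qed.
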